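(* Let $A\in\mathbf{B}_0^+(\mathcal{H})$ with $\operatorname{ran}A\neq\mathcal{H}$. Then there is an increasing sequence $\mathfrak{N}_1\subset\mathfrak{N}_2\subset\cdots$ of subspaces of $\mathcal{H}$ such that (1) $\mathfrak{N}_k\cap\operatorname{ran}A^{1/2}=\mathfrak{N}_k^\perp\cap\operatorname{ran}A^{1/2}=\{0\}$ for all $k\in\mathbb{N}$; (2) $\bigcap_{k\in\mathbb{N}}\mathfrak{N}_k^\perp=\{0\}$; (3) $P_{\mathfrak{N}_k}\to I_{\mathcal{H}}$ strongly as $k\to\infty$.
   Context: $\mathcal{H}$ is a complex, infinite-dimensional, separable Hilbert space. A subspace means a closed linear subspace; $\mathfrak{N}^\perp=\mathcal{H}\ominus\mathfrak{N}$; $P_{\mathfrak{N}}$ is the orthogonal projection onto $\mathfrak{N}$. $\mathbf{B}_0^+(\mathcal{H})$ denotes the bounded self-adjoint non-negative operators on $\mathcal{H}$ with trivial kernel. *)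

(* Defs.v *)
From Stdlib Require Import Reals.
Open Scope R_scope.

Record Cx := mkCx { Cre : R; Cim : R }.
Definition C0 : Cx := mkCx 0 0.
Definition C1 : Cx := mkCx 1 0.
Definition Cadd (a b : Cx) : Cx := mkCx (Cre a + Cre b) (Cim a + Cim b).
Definition Cmul (a b : Cx) : Cx :=
  mkCx (Cre a * Cre b - Cim a * Cim b) (Cre a * Cim b + Cim a * Cre b).
Definition Cconj (a : Cx) : Cx := mkCx (Cre a) (- Cim a).

Record Hilbert := {
  hcar :> Type;
  vadd : hcar -> hcar -> hcar;
  vzero : hcar;
  vopp : hcar -> hcar;
  vscal : Cx -> hcar -> hcar;
  inner : hcar -> hcar -> Cx;
  vadd_assoc : forall x y z, vadd x (vadd y z) = vadd (vadd x y) z;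
  vadd_comm : forall x y, vadd x y = vadd y x;
  vadd_0 : forall x, vadd x vzero = x;
  vadd_opp : forall x, vadd x (vopp x) = vzero;
  vscal_1 : forall x, vscal C1 x = x;
  vscal_assoc : forall a b x, vscal a (vscal b x) = vscal (Cmul a b) x;
  vscal_addv : forall a x y, vscal a (vadd x y) = vadd (vscal a x) (vscal a y);
  vscal_adds : forall a b x, vscal (Cadd a b) x = vadd (vscal a x) (vscal b x);
  inner_add_l : forall x y z, inner (vadd x y) z = Cadd (inner x z) (inner y z);
  inner_scal_l : forall a x z, inner (vscal a x) z = Cmul a (inner x z);
  inner_conj : forall x y, inner y x = Cconj (inner x y);
  inner_pos : forall x, 0 <= Cre (inner x x);
  inner_def : forall x, inner x x = C0 -> x = vzero;
  complete : forall u : nat -> hcar,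
    (forall eps, 0 < eps -> exists N, forall n m, (n >= N)%nat -> (m >= N)%nat ->
        sqrt (Cre (inner (vadd (u n) (vopp (u m))) (vadd (u n) (vopp (u m))))) < eps) ->
    exists l, forall eps, 0 < eps -> exists N, forall n, (n >= N)%nat ->
        sqrt (Cre (inner (vadd (u n) (vopp l)) (vadd (u n) (vopp l)))) < eps;
  separable : exists d : nat -> hcar, forall x eps, 0 < eps -> exists n,
        sqrt (Cre (inner (vadd x (vopp (d n))) (vadd x (vopp (d n))))) < eps;
  infdim : forall n : nat, exists e : nat -> hcar, forall i j, (i < n)%nat -> (j < n)%nat ->
        inner (e i) (e j) = if Nat.eq_dec i j then C1 else C0
}.

Arguments vadd {h}. Arguments vzero {h}. Arguments vopp {h}.
Arguments vscal {h}. Arguments inner {h}.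

Section Ops.
Context {H : Hilbert}.

Definition vsub (x y : H) : H := vadd x (vopp y).
Definition hnorm (x : H) : R := sqrt (Cre (inner x x)).

Definition is_linear (T : H -> H) : Prop :=
  (forall x y, T (vadd x y) = vadd (T x) (T y)) /\
  (forall a x, T (vscal a x) = vscal a (T x)).
Definition is_bounded_op (T : H -> H) : Prop :=
  is_linear T /\ exists M, forall x, hnorm (T x) <= M * hnorm x.
Definition selfadjoint (T : H -> H) : Prop :=
  forall x y, inner (T x) y = inner x (T y).
Definition nonneg_op (T : H -> H) : Prop :=
  forall x, 0 <= Cre (inner (T x) x).
Definition trivial_kernel (T : H -> H) : Prop :=
  forall x, T x = vzero -> x = vzero.

Definition B0plus (A : H -> H) : Prop :=
  is_bounded_op A /\ selfadjoint A /\ nonneg_op A /\ trivial_kernel A.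

Definition ran (T : H -> H) (y : H) : Prop := exists x, T x = y.

Definition is_sqrt (A B : H -> H) : Prop :=
  is_bounded_op B /\ selfadjoint B /\ nonneg_op B /\ forall x, B (B x) = A x.

Definition ran_sqrt (A : H -> H) (y : H) : Prop :=
  exists B, is_sqrt A B /\ ran B y.

Definition subspace (N : H -> Prop) : Prop :=
  N vzero /\
  (forall x y, N x -> N y -> N (vadd x y)) /\
  (forall a x, N x -> N (vscal a x)) /\
  (forall (u : nat -> H) l, (forall n, N (u n)) ->
     (forall eps, 0 < eps -> exists K, forall n, (n >= K)%nat -> hnorm (vsub (u n) l) < eps) ->
     N l).

Definition orth (N : H -> Prop) (x : H) : Prop :=
  forall y, N y -> inner x y = C0.

Definition is_proj (N : H -> Prop) (x p : H) : Prop :=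
  N p /\ orth N (vsub x p).

End Ops.

(* Main.v *)
(** If [w = A^(1/2) z], then [|<w,e>|^2 <= |z|^2 <A e, e>], so vectors of [ran A^(1/2)] have tiny
    coordinates along vectors [e] on which the form of [A] is tiny.  As [A] is injective but not
    onto, such [e] exist orthogonally to any finite set; hence there is an orthonormal basis
    [(b n)] such that every [w] in [ran A^(1/2)] satisfies [<w, b n> = O(16^-n)] for odd [n].
    Make the indices into a two-coloured forest in which every vertex has infinitely many odd
    children of both colours, and let [T], from the span [X] of one colour to the span [Y] of the
    other, be the self-transposed matrix with entry [4^-n] between [n] and its parent.
    A coordinate [c] of a vector reappears, multiplied by [4^-n], at each of its children [n] in
    the image; as this is much larger than [16^-n], neither the graph of [T] nor its orthogonal
    complement meets [ran A^(1/2)] outside [0].  The remaining children of an [X]-vertex [i], those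
    in [X], define [gamma i = b i + sum 4^-n b n]; the [gamma i] span a dense subspace of [X],
    and [N k] is the complement of the graph enlarged by the [gamma i] with [i < k]. *)
From Stdlib Require Import Reals Lra Lia Arith List Cantor Classical IndefiniteDescription.
Require Import Defs.
Open Scope R_scope.

(** * The underlying real Hilbert space *)

Section RealInner.
Context {H : Hilbert}.
Implicit Types x y z : H.

Definition rin x y : R := Cre (inner x y).
Definition rs (r : R) x : H := vscal (mkCx r 0) x.
Definition J x : H := vscal (mkCx 0 1) x.

Lemma Cx_eq (a b : Cx) : Cre a = Cre b -> Cim a = Cim b -> a = b.
Proof. destruct a, b; simpl; congruence. Qed.

(** With multiplication by i the real form recovers the complex inner product, so orthogonality
    becomes two real equations. *)
Lemma inner_rin x y : inner x y = mkCx (rin x y) (- rin (J x) y).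
Proof.
  apply Cx_eq; unfold rin, J; simpl; auto.
  rewrite inner_scal_l; simpl; ring.
Qed.

Lemma rin_sym x y : rin x y = rin y x.
Proof. unfold rin. rewrite (inner_conj _ y x). reflexivity. Qed.

Lemma rin_add_l x y z : rin (vadd x y) z = rin x z + rin y z.
Proof. unfold rin. rewrite inner_add_l. reflexivity. Qed.
Lemma rin_add_r x y z : rin x (vadd y z) = rin x y + rin x z.
Proof. now rewrite rin_sym, rin_add_l, (rin_sym y), (rin_sym z). Qed.
Lemma rin_0_l x : rin vzero x = 0.
Proof. pose proof (rin_add_l vzero vzero x) as h. rewrite vadd_0 in h. lra. Qed.
Lemma rin_opp_l x y : rin (vopp x) y = - rin x y.
Proof.
  pose proof (rin_add_l x (vopp x) y) as h. rewrite vadd_opp, rin_0_l in h. lra.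
Qed.
Lemma rin_opp_r x y : rin x (vopp y) = - rin x y.
Proof. now rewrite rin_sym, rin_opp_l, (rin_sym y). Qed.
Lemma rin_rs_l r x y : rin (rs r x) y = r * rin x y.
Proof. unfold rin, rs. rewrite inner_scal_l; simpl; ring. Qed.
Lemma rin_rs_r r x y : rin x (rs r y) = r * rin x y.
Proof. now rewrite rin_sym, rin_rs_l, (rin_sym y). Qed.
Lemma rin_J_r x y : rin x (J y) = - rin (J x) y.
Proof.
  rewrite rin_sym. pose proof (inner_conj _ x y) as h.
  rewrite (inner_rin x y), (inner_rin y x) in h.
  unfold Cconj in h; simpl in h. injection h; intros. lra.
Qed.
Lemma rin_pos x : 0 <= rin x x.
Proof. apply inner_pos. Qed.

Lemma rin_sub_l x y z : rin (vsub x y) z = rin x z - rin y z.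
Proof. unfold vsub. rewrite rin_add_l, rin_opp_l. lra. Qed.
Lemma rin_sub_r x y z : rin x (vsub y z) = rin x y - rin x z.
Proof. unfold vsub. rewrite rin_add_r, rin_opp_r. lra. Qed.

Lemma rin_self_0 x : rin x x = 0 -> x = vzero.
Proof.
  intro h. apply inner_def. rewrite inner_rin, h.
  assert (h' : rin (J x) x = 0) by (pose proof (rin_J_r x x) as e; rewrite rin_sym in e; lra).
  rewrite h'. unfold C0. f_equal; lra.
Qed.

Lemma vopp_unique x y : vadd x (vopp y) = vzero -> x = y.
Proof.
  intro h. rewrite <- (vadd_0 _ x), <- (vadd_opp _ y), (vadd_comm _ y), vadd_assoc, h.
  now rewrite vadd_comm, vadd_0.
Qed.

(** Vector identities are tested against every [z], which leaves real identities for [rin_simpl] and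
    [ring]. *)
Lemma rin_ext x y : (forall z, rin x z = rin y z) -> x = y.
Proof.
  intro h. apply vopp_unique, rin_self_0. fold (vsub x y).
  rewrite rin_sub_l, h. lra.
Qed.

Lemma J_J x : J (J x) = vopp x.
Proof.
  apply rin_ext; intro z. rewrite rin_opp_l. unfold J, rin.
  rewrite vscal_assoc, inner_scal_l; simpl; ring.
Qed.
Lemma J_add x y : J (vadd x y) = vadd (J x) (J y).
Proof. apply vscal_addv. Qed.
Lemma J_opp x : J (vopp x) = vopp (J x).
Proof.
  apply rin_ext; intro z. rewrite rin_opp_l.
  pose proof (rin_J_r (vopp x) z). pose proof (rin_J_r x z).
  rewrite rin_opp_l in *. lra.
Qed.
Lemma J_rs r x : J (rs r x) = rs r (J x).
Proof.
  unfold J, rs. rewrite !vscal_assoc. f_equal. apply Cx_eq; simpl; ring.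
Qed.
Lemma J_sub x y : J (vsub x y) = vsub (J x) (J y).
Proof. unfold vsub. now rewrite J_add, J_opp. Qed.

Lemma vscal_split a x : vscal a x = vadd (rs (Cre a) x) (rs (Cim a) (J x)).
Proof.
  unfold rs, J. rewrite vscal_assoc, <- vscal_adds. f_equal. apply Cx_eq; simpl; ring.
Qed.

Lemma inner_eq_C0 x y : inner x y = C0 <-> rin x y = 0 /\ rin (J x) y = 0.
Proof.
  rewrite inner_rin. unfold C0. split.
  - intro h; injection h; intros; lra.
  - intros [-> ->]. f_equal; lra.
Qed.
Lemma inner_C0_sym x y : inner x y = C0 -> inner y x = C0.
Proof.
  rewrite !inner_eq_C0. intros [h1 h2]. rewrite (rin_sym y x), (rin_sym _ x), rin_J_r. lra.
Qed.
End RealInner.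

Ltac rin_simpl :=
  repeat first [ rewrite rin_add_l | rewrite rin_add_r | rewrite rin_sub_l | rewrite rin_sub_r
               | rewrite rin_opp_l | rewrite rin_opp_r | rewrite rin_rs_l | rewrite rin_rs_r
               | rewrite J_add | rewrite J_sub | rewrite J_opp | rewrite J_rs | rewrite J_J
               | rewrite rin_J_r ].

(** * Cauchy-Schwarz, limits and orthogonal complements *)

Section Metric.
Context {H : Hilbert}.
Implicit Types x y z : H.

(** Stated for general nonnegative symmetric forms, as it serves both the inner product and the form
    of [A]. *)
Lemma cauchy_schwarz_form (f : H -> H -> R) :
  (forall x y, f x y = f y x) ->
  (forall x y z, f (vadd x y) z = f x z + f y z) ->
  (forall r x z, f (rs r x) z = r * f x z) ->
  (forall x, 0 <= f x x) ->
  forall x y, (f x y)² <= f x x * f y y.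
Proof.
  intros fs fa fr fp x y.
  assert (Q : forall s t, 0 <= s * s * f x x + 2 * (s * t) * f x y + t * t * f y y).
  { intros s t. pose proof (fp (vadd (rs s x) (rs t y))) as h.
    rewrite fa, !fr, (fs x), (fs y), !fa, !fr, (fs y x) in h. lra. }
  unfold Rsqr.
  destruct (Req_dec (f y y) 0) as [e|ne].
  - rewrite e. destruct (Req_dec (f x y) 0) as [e'|ne']; [rewrite e'; lra|].
    (* When [f y y = 0], this choice of [t] would give the quadratic the value -1. *)
    pose proof (Q 1 (- (f x x + 1) / (2 * f x y))) as h. rewrite e in h.
    replace (2 * (1 * (- (f x x + 1) / (2 * f x y))) * f x y) with (- (f x x + 1)) in h
      by (field; auto). lra.
  - pose proof (fp y). pose proof (Q (f y y) (- f x y)) as h.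
    apply Rmult_le_reg_l with (f y y); nra.
Qed.

Lemma cauchy_schwarz x y : (rin x y)² <= rin x x * rin y y.
Proof.
  apply (cauchy_schwarz_form rin).
  - apply rin_sym. - apply rin_add_l. - apply rin_rs_l. - apply rin_pos.
Qed.

Lemma hnorm_lt x eps : 0 < eps -> (hnorm x < eps <-> rin x x < eps²).
Proof.
  intro he. unfold hnorm; fold (rin x x). pose proof (rin_pos x). split; intro h.
  - rewrite <- (sqrt_def (rin x x)) by auto. fold (Rsqr (sqrt (rin x x))).
    apply Rsqr_incrst_1; auto using sqrt_pos; lra.
  - rewrite <- (sqrt_Rsqr eps) by lra. apply sqrt_lt_1; auto. apply Rle_0_sqr.
Qed.

Definition vcv (u : nat -> H) (l : H) : Prop :=
  forall eps, 0 < eps -> exists K, forall n, (n >= K)%nat ->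
     rin (vsub (u n) l) (vsub (u n) l) < eps.

Lemma complete_sq (u : nat -> H) :
  (forall eps, 0 < eps -> exists K, forall n m, (n >= K)%nat -> (m >= K)%nat ->
     rin (vsub (u n) (u m)) (vsub (u n) (u m)) < eps) ->
  exists l, vcv u l.
Proof.
  intro h. destruct (complete H u) as [l hl].
  - intros eps he. destruct (h (eps²)) as [K hK]; [unfold Rsqr; nra|].
    exists K; intros n m hn hm. apply (hnorm_lt (vsub (u n) (u m))); auto.
  - exists l. intros eps he. destruct (hl (sqrt eps)) as [K hK]; [now apply sqrt_lt_R0|].
    exists K; intros n hn. rewrite <- (Rsqr_sqrt eps) by lra.
    apply hnorm_lt; [now apply sqrt_lt_R0|]. apply hK; auto.
Qed.

Lemma vcv_rin u l y : vcv u l -> Un_cv (fun n => rin (u n) y) (rin l y).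
Proof.
  intros h eps he.
  destruct (h (eps² / (rin y y + 1))) as [K hK].
  { pose proof (rin_pos y). apply Rdiv_lt_0_compat; unfold Rsqr; nra. }
  exists K; intros n hn. specialize (hK n hn). unfold Rdist.
  rewrite <- rin_sub_l. pose proof (cauchy_schwarz (vsub (u n) l) y) as cs.
  pose proof (rin_pos y). rewrite <- (Rabs_pos_eq eps) by lra. apply Rsqr_lt_abs_0.
  apply Rle_lt_trans with (1 := cs).
  apply Rle_lt_trans with (rin (vsub (u n) l) (vsub (u n) l) * (rin y y + 1)).
  - pose proof (rin_pos (vsub (u n) l)). lra.
  - apply Rmult_lt_compat_r with (r := rin y y + 1) in hK; [|lra].
    unfold Rdiv in hK. rewrite Rmult_assoc, Rinv_l, Rmult_1_r in hK; lra.
Qed.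

Lemma Un_cv_const_eq (u : nat -> R) l c : Un_cv u l -> (exists K, forall n, (n >= K)%nat -> u n = c) -> l = c.
Proof.
  intros h [K hK]. apply (UL_sequence u); auto.
  intros eps he. exists K. intros n hn. rewrite hK by auto. unfold Rdist. 
  rewrite Rminus_diag, Rabs_R0. auto.
Qed.

Lemma vcv_J u l : vcv u l -> vcv (fun n => J (u n)) (J l).
Proof.
  intros h eps he. destruct (h eps he) as [K hK]. exists K; intros n hn.
  specialize (hK n hn). rewrite <- J_sub, rin_J_r, J_J, rin_opp_l. lra.
Qed.

(** All subspaces of the construction are orthogonal complements, which this makes closed. *)
Lemma subspace_orth (S : H -> Prop) : subspace (orth S).
Proof.
  repeat split.
  - intros y hy. apply inner_eq_C0. split; [apply rin_0_l|].
    rewrite <- (Ropp_involutive (rin _ _)), <- rin_J_r, rin_0_l; lra.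
  - intros x y hx hy z hz. rewrite inner_add_l, hx, hy by auto.
    apply Cx_eq; simpl; ring.
  - intros a x hx z hz. rewrite inner_scal_l, hx by auto. apply Cx_eq; simpl; ring.
  - intros u l hu hl y hy.
    assert (c : vcv u l).
    { intros eps he. destruct (hl (sqrt eps)) as [K hK]; [now apply sqrt_lt_R0|].
      exists K; intros n hn. rewrite <- (Rsqr_sqrt eps) by lra.
      apply hnorm_lt; [now apply sqrt_lt_R0|]. apply hK; auto. }
    apply inner_eq_C0; split.
    + apply (Un_cv_const_eq _ _ _ (vcv_rin _ _ y c)). exists 0%nat; intros n _.
      now apply inner_eq_C0, (hu n).
    + apply (Un_cv_const_eq _ _ _ (vcv_rin _ _ y (vcv_J _ _ c))). exists 0%nat; intros n _.
      now apply inner_eq_C0, (hu n).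
Qed.

Lemma orth_antitone (S T : H -> Prop) x : (forall y, S y -> T y) -> orth T x -> orth S x.
Proof. intros h hx y hy. apply hx; auto. Qed.

(* The residuals [x - p k] satisfy [|r k|^2 = |r l|^2 + |r k - r l|^2] for [k <= l], so they
   are Cauchy, and their limit lies in every [orth (N k)]. *)
Lemma monotone_proj_cv (N : nat -> H -> Prop) :
  (forall k, subspace (N k)) ->
  (forall k x, N k x -> N (S k) x) ->
  (forall x, (forall k, orth (N k) x) -> x = vzero) ->
  forall (x : H) (p : nat -> H), (forall k, is_proj (N k) x (p k)) ->
  forall eps, 0 < eps -> exists K, forall k, (k >= K)%nat -> hnorm (vsub x (p k)) < eps.
Proof.
  intros hs hinc h0 x p hp.
  assert (mon : forall k l y, (k <= l)%nat -> N k y -> N l y).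
  { intros k l y hkl; induction hkl; auto. }
  set (r := fun k => vsub x (p k)).
  assert (pyth : forall k l, (k <= l)%nat ->
    rin (r k) (r k) = rin (r l) (r l) + rin (vsub (r k) (r l)) (vsub (r k) (r l))).
  { intros k l hkl.
    assert (o : rin (r l) (vsub (p l) (p k)) = 0).
    { rewrite rin_sub_r.
      destruct (hp l) as [hl ol]. destruct (hp k) as [hk _].
      pose proof (proj1 (proj1 (inner_eq_C0 _ _) (ol (p l) hl))).
      pose proof (proj1 (proj1 (inner_eq_C0 _ _) (ol (p k) (mon k l _ hkl hk)))).
      unfold r. lra. }
    assert (e : vsub (r k) (r l) = vsub (p l) (p k)).
    { apply rin_ext; intro z. unfold r. rin_simpl. ring. }
    assert (e' : r k = vadd (r l) (vsub (p l) (p k))).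
    { apply rin_ext; intro z. unfold r. rin_simpl. ring. }
    rewrite e, e'. rewrite !rin_add_l, !rin_add_r, (rin_sym (vsub (p l) (p k)) (r l)), o. ring. }
  assert (dec : Un_decreasing (fun k => rin (r k) (r k))).
  { intro k. rewrite (pyth k (S k)) by lia.
    pose proof (rin_pos (vsub (r k) (r (S k)))). lra. }
  assert (lb : has_lb (fun k => rin (r k) (r k))).
  { exists 0. intros y [k ->]. unfold opp_seq. pose proof (rin_pos (r k)). lra. }
  pose proof (CV_Cauchy _ (decreasing_cv _ dec lb)) as cau.
  destruct (complete_sq r) as [l hl].
  { intros eps he. destruct (cau eps he) as [K hK]. exists K; intros n m hn hm.
    specialize (hK n m hn hm). unfold Rdist in hK.
    destruct (Nat.le_ge_cases n m) as [h|h]; pose proof (pyth _ _ h) as e.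
    - rewrite Rabs_pos_eq in hK; pose proof (rin_pos (vsub (r n) (r m))); lra.
    - replace (rin (vsub (r n) (r m)) (vsub (r n) (r m)))
        with (rin (vsub (r m) (r n)) (vsub (r m) (r n))) by (rin_simpl; ring).
      rewrite Rabs_minus_sym in hK.
      rewrite Rabs_pos_eq in hK; pose proof (rin_pos (vsub (r m) (r n))); lra. }
  assert (l0 : l = vzero).
  { apply h0. intros k y hy.
    assert (o : forall n, (n >= k)%nat -> inner (r n) y = C0).
    { intros n hn. apply (proj2 (hp n)). apply mon with k; auto. }
    apply inner_eq_C0; split.
    - apply (Un_cv_const_eq _ _ _ (vcv_rin _ _ y hl)). exists k; intros n hn.
      now apply inner_eq_C0, o.
    - apply (Un_cv_const_eq _ _ _ (vcv_rin _ _ y (vcv_J _ _ hl))). exists k; intros n hn.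
      now apply inner_eq_C0, o. }
  intros eps he. destruct (hl (eps²)) as [K hK]; [unfold Rsqr; nra|].
  exists K; intros k hk. apply hnorm_lt; auto. specialize (hK k hk).
  rewrite l0 in hK. fold (r k).
  replace (r k) with (vsub (r k) vzero); auto.
  apply rin_ext; intro z. rewrite rin_sub_l, rin_0_l. lra.
Qed.

End Metric.

(** * Vectors on which the form is small *)

Section SmallVectors.
Context {H : Hilbert} (A : H -> H) (HA : B0plus A).
Implicit Types a d x y z : H.

Lemma A_add x y : A (vadd x y) = vadd (A x) (A y).
Proof. apply HA. Qed.
Lemma A_scal (a : Cx) x : A (vscal a x) = vscal a (A x).
Proof. apply HA. Qed.
Lemma A_rs r x : A (rs r x) = rs r (A x).
Proof. apply A_scal. Qed.
Lemma A_opp x : A (vopp x) = vopp (A x).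
Proof.
  assert (e : forall z : H, vopp z = rs (-1) z) by (intro; apply rin_ext; intro; rin_simpl; ring).
  now rewrite !e, A_rs.
Qed.
Lemma A_sub x y : A (vsub x y) = vsub (A x) (A y).
Proof. unfold vsub. now rewrite A_add, A_opp. Qed.
Lemma A_sym x y : rin (A x) y = rin x (A y).
Proof. unfold rin. destruct HA as (_ & h & _). now rewrite h. Qed.
Lemma A_pos x : 0 <= rin (A x) x.
Proof. apply HA. Qed.
Lemma A_cs x y : (rin (A x) y)² <= rin (A x) x * rin (A y) y.
Proof.
  apply (cauchy_schwarz_form (fun x y => rin (A x) y)).
  - intros a c. now rewrite A_sym, rin_sym.
  - intros a c d. now rewrite A_add, rin_add_l.
  - intros r a c. now rewrite A_rs, rin_rs_l.
  - apply A_pos.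
Qed.
Lemma A_sub_le x y : rin (A (vsub x y)) (vsub x y) <= 2 * rin (A x) x + 2 * rin (A y) y.
Proof.
  pose proof (A_pos (vadd x y)) as h. rewrite A_add in h. rewrite A_sub.
  revert h. rin_simpl. lra.
Qed.

Lemma rin_vscal (a : Cx) x y : rin (vscal a x) (vscal a y) = ((Cre a)² + (Cim a)²) * rin x y.
Proof. rewrite vscal_split, (vscal_split a y). unfold Rsqr. rin_simpl. ring. Qed.

Lemma A_vscal (a : Cx) x : rin (A (vscal a x)) (vscal a x) = ((Cre a)² + (Cim a)²) * rin (A x) x.
Proof. now rewrite A_scal, rin_vscal. Qed.

Lemma A_bounded : exists M, 0 < M /\ forall x, rin (A x) (A x) <= M * rin x x.
Proof.
  destruct HA as ((_ & M & hM) & _).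
  exists (M² + 1). split; [pose proof (Rle_0_sqr M); lra|].
  intro x. specialize (hM x). unfold hnorm in hM. fold (rin (A x) (A x)) (rin x x) in hM.
  pose proof (rin_pos x). pose proof (rin_pos (A x)).
  rewrite <- (sqrt_def (rin (A x) (A x))) by auto.
  pose proof (sqrt_pos (rin (A x) (A x))). pose proof (sqrt_pos (rin x x)).
  pose proof (sqrt_def (rin x x) (rin_pos x)) as e.
  set (s := sqrt (rin (A x) (A x))) in *. set (t := sqrt (rin x x)) in *.
  rewrite <- e. unfold Rsqr. nra.
Qed.

(* Richardson iteration [x <- x + t (y - A x)]: its residuals contract by the factor [rho]. *)
Lemma coercive_onto c : 0 < c -> (forall x, c * rin x x <= rin (A x) x) -> forall y, ran A y.
Proof.
  intros hc hq y. destruct A_bounded as (M & hM & bM).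
  (* This [t] minimises [1 - 2 t c + t^2 M], which bounds the factor by which a squared residual
     shrinks; the minimum is [1 - c^2 / M]. *)
  set (t := c / M).
  set (x := fix x n := match n with O => vzero | S n => vadd (x n) (rs t (vsub y (A (x n)))) end).
  set (r := fun n => vsub y (A (x n))).
  set (rho := Rmax 0 (1 - c² / M)).
  assert (ht : 0 < t) by (apply Rdiv_lt_0_compat; auto).
  assert (hrho : 0 <= rho < 1).
  { unfold rho. split; [apply Rmax_l|]. apply Rmax_lub_lt; [lra|].
    assert (0 < c² / M) by (apply Rdiv_lt_0_compat; unfold Rsqr; nra). lra. }
  assert (step : forall n, rin (r (S n)) (r (S n)) <= rho * rin (r n) (r n)).
  { intro n.
    assert (e : r (S n) = vsub (r n) (rs t (A (r n)))).
    { unfold r at 1. simpl. fold (r n). rewrite A_add, A_rs.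
      apply rin_ext; intro z. unfold r. rin_simpl. ring. }
    rewrite e. rewrite rin_sub_l, !rin_sub_r, !rin_rs_l, !rin_rs_r, (rin_sym (r n) (A _)).
    pose proof (hq (r n)). pose proof (bM (r n)). pose proof (rin_pos (r n)).
    apply Rle_trans with ((1 - c² / M) * rin (r n) (r n)).
    - replace (c² / M) with (2 * t * c - t * t * M) by (unfold t, Rsqr; field; lra).
      assert (t * (c * rin (r n) (r n)) <= t * rin (A (r n)) (r n)) by (apply Rmult_le_compat_l; lra).
      assert (t * t * rin (A (r n)) (A (r n)) <= t * t * (M * rin (r n) (r n)))
        by (apply Rmult_le_compat_l; [nra|lra]).
      lra.
    - apply Rmult_le_compat_r; auto. apply Rmax_r. }
  assert (geo : forall n, rin (r n) (r n) <= rho ^ n * rin (r 0%nat) (r 0%nat)).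
  { induction n; simpl pow; [lra|]. pose proof (step n). nra. }
  assert (small : forall eps, 0 < eps -> exists K, forall n, (n >= K)%nat -> rin (r n) (r n) < eps).
  { intros eps he. set (D := rin (r 0%nat) (r 0%nat)) in *.
    assert (0 <= D) by apply rin_pos.
    destruct (pow_lt_1_zero rho ltac:(rewrite Rabs_pos_eq; lra) (eps / (D + 1))) as [K hK].
    { apply Rdiv_lt_0_compat; lra. }
    exists K; intros n hn. specialize (hK n hn).
    rewrite Rabs_pos_eq in hK by (apply pow_le; lra).
    apply Rmult_lt_compat_r with (r := D + 1) in hK; [|lra].
    unfold Rdiv in hK. rewrite Rmult_assoc, Rinv_l, Rmult_1_r in hK by lra.
    pose proof (geo n). pose proof (pow_le rho n ltac:(lra)). nra. }
  (* By Cauchy-Schwarz [A] is bounded below in norm, so small residuals make the iterates Cauchy. *)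
  assert (coer : forall z, c² * rin z z <= rin (A z) (A z)).
  { intro z. pose proof (hq z) as h. pose proof (cauchy_schwarz (A z) z) as cs.
    pose proof (rin_pos z). pose proof (rin_pos (A z)). unfold Rsqr in *.
    destruct (Req_dec (rin z z) 0) as [e0|ne]; [rewrite e0; lra|].
    apply Rmult_le_reg_r with (rin z z); [lra|].
    apply Rle_trans with (rin (A z) z * rin (A z) z); auto.
    replace (c * c * rin z z * rin z z) with ((c * rin z z) * (c * rin z z)) by ring.
    assert (0 <= c * rin z z) by nra. apply Rmult_le_compat; auto. }
  destruct (complete_sq x) as [l hl].
  { intros eps he.
    destruct (small (c² * eps / 4)) as [K hK]; [apply Rdiv_lt_0_compat; [apply Rmult_lt_0_compat; [unfold Rsqr; nra|auto]|lra]|].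
    exists K; intros n m hn hm. pose proof (hK n hn). pose proof (hK m hm).
    pose proof (coer (vsub (x n) (x m))) as h.
    assert (e : A (vsub (x n) (x m)) = vsub (r m) (r n)).
    { rewrite A_sub. apply rin_ext; intro z. unfold r. rin_simpl. ring. }
    rewrite e in h.
    assert (rin (vsub (r m) (r n)) (vsub (r m) (r n)) <= 2 * rin (r m) (r m) + 2 * rin (r n) (r n)).
    { pose proof (rin_pos (vadd (r m) (r n))) as p. revert p. rin_simpl. lra. }
    assert (0 < c²) by (unfold Rsqr; nra).
    apply Rmult_lt_reg_l with (c²); lra. }
  exists l. apply rin_ext; intro z.
  assert (c1 : Un_cv (fun n => rin (r n) z) (rin y z - rin (A l) z)).
  { pose proof (vcv_rin x l (A z) hl) as h. rewrite A_sym. intros eps he.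
    destruct (h eps he) as [K hK]. exists K; intros n hn. specialize (hK n hn).
    unfold Rdist in *. unfold r. rewrite rin_sub_l, A_sym. rewrite Rabs_minus_sym in hK.
    replace (rin y z - rin (x n) (A z) - (rin y z - rin l (A z)))
      with (rin l (A z) - rin (x n) (A z)) by ring. auto. }
  assert (c2 : Un_cv (fun n => rin (r n) z) (rin vzero z)).
  { apply vcv_rin. intros eps he. destruct (small eps he) as [K hK].
    exists K; intros n hn. replace (vsub (r n) vzero) with (r n); auto.
    apply rin_ext; intro w. rewrite rin_sub_l, rin_0_l. ring. }
  pose proof (UL_sequence _ _ _ c1 c2) as e. rewrite rin_0_l in e. lra.
Qed.

(** * Orthonormal lists and a basis adapted to the operator *)

Fixpoint orthonormal (L : list H) : Prop :=
  match L with
  | nil => True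
  | a :: L' => inner a a = C1 /\ (forall x, In x L' -> inner a x = C0) /\ orthonormal L'
  end.

Definition perp (L : list H) (x : H) : Prop := forall a, In a L -> inner x a = C0.

Lemma perp_add L x y : perp L x -> perp L y -> perp L (vadd x y).
Proof. intros hx hy a h. rewrite inner_add_l, hx, hy by auto. apply Cx_eq; simpl; ring. Qed.
Lemma perp_scal L (a : Cx) x : perp L x -> perp L (vscal a x).
Proof. intros hx b h. rewrite inner_scal_l, hx by auto. apply Cx_eq; simpl; ring. Qed.
Lemma vsub_rs x y : vsub x y = vadd x (vscal (mkCx (-1) 0) y).
Proof. apply rin_ext; intro z. fold (rs (-1) y). rin_simpl. ring. Qed.
Lemma perp_sub L x y : perp L x -> perp L y -> perp L (vsub x y).
Proof. intros. rewrite vsub_rs. auto using perp_add, perp_scal. Qed.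

Lemma rin_eq_1 a : inner a a = C1 -> rin a a = 1 /\ rin (J a) a = 0.
Proof. rewrite inner_rin. unfold C1. intro h. injection h; intros. lra. Qed.

Lemma inner_sub_proj x a : inner a a = C1 -> inner (vsub x (vscal (inner x a) a)) a = C0.
Proof.
  intro h. rewrite vsub_rs, inner_add_l, vscal_assoc, inner_scal_l, h.
  apply Cx_eq; simpl; ring.
Qed.

Hypothesis not_onto : exists y, ~ ran A y.

(* If [A] were coercive on [(a :: L)^perp] while small at some [f n _|_ L], normalised by
   [<f n, a> = 1], then [f n] would be Cauchy, with a nonzero limit in the kernel of [A]. *)
Lemma small_vector_step L a : inner a a = C1 -> (forall x, In x L -> inner a x = C0) ->
  (forall eps, 0 < eps -> exists x, perp L x /\ 0 < rin x x /\ rin (A x) x <= eps * rin x x) ->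
  (forall eps, 0 < eps -> exists x, perp (a :: L) x /\ 0 < rin x x /\ rin (A x) x <= eps * rin x x).
Proof.
  intros ha haL hL eps he. apply NNPP. intro neg.
  assert (coer : forall x, perp (a :: L) x -> eps * rin x x <= rin (A x) x).
  { intros x hx. pose proof (rin_pos x) as p. destruct (Req_dec (rin x x) 0) as [e|ne].
    - rewrite e. pose proof (A_pos x). lra.
    - apply Rnot_lt_le. intro lt. apply neg. exists x. repeat split; auto; lra. }
  destruct (rin_eq_1 a ha) as [a1 a2].
  set (qa := rin (A a) a). assert (hqa : 0 <= qa) by apply A_pos.
  assert (F : forall eta, 0 < eta -> exists f, perp L f /\ inner f a = C1 /\ rin (A f) f <= eta).
  { intros eta heta.
    (* [dl] bounds from below the share of [|x|^2] along [a]: coercivity at the part of [x]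
       orthogonal to [a] gives [eps (|x|^2 - b2) <= 2 e1 |x|^2 + 2 qa b2], and [e1 <= eps / 4]
       absorbs the first term. The other bound on [e1] yields [eta]. *)
    set (dl := eps / (4 * (qa + eps))).
    assert (hdl : 0 < dl) by (apply Rdiv_lt_0_compat; lra).
    set (e1 := Rmin (eps / 4) (eta * dl)).
    assert (he1 : 0 < e1) by (apply Rmin_pos; [lra|nra]).
    destruct (hL e1 he1) as (x & px & nx & qx).
    pose proof (Rmin_l (eps / 4) (eta * dl)). pose proof (Rmin_r (eps / 4) (eta * dl)).
    fold e1 in H0, H1.
    set (be := inner x a). set (b2 := (Cre be)² + (Cim be)²).
    set (x' := vsub x (vscal be a)).
    assert (px' : perp (a :: L) x').
    { intros c [<-|hc].
      - now apply inner_sub_proj.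
      - apply perp_sub with (L := L); auto. apply perp_scal; auto. }
    assert (n' : rin x' x' = rin x x - b2).
    { assert (e : rin x x = rin (vadd x' (vscal be a)) (vadd x' (vscal be a))).
      { replace (vadd x' (vscal be a)) with x; auto.
        apply rin_ext; intro z; unfold x'. rin_simpl. ring. }
      assert (o : rin x' (vscal be a) = 0).
      { pose proof (px' a (or_introl eq_refl)) as o. apply inner_eq_C0 in o as [o1 o2].
        rewrite vscal_split. rin_simpl. rewrite o1, o2. ring. }
      rewrite rin_add_l, !rin_add_r, (rin_sym (vscal be a) x'), o, rin_vscal, a1 in e. fold b2 in e. lra. }
    pose proof (coer x' px') as c1. rewrite n' in c1.
    pose proof (A_sub_le x (vscal be a)) as c2. fold x' in c2.
    rewrite A_vscal in c2. fold b2 qa in c2.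
    assert (lb : dl * rin x x <= b2).
    { unfold dl. apply Rmult_le_reg_l with (4 * (qa + eps)); [lra|].
      replace (4 * (qa + eps) * (eps / (4 * (qa + eps)) * rin x x)) with (eps * rin x x)
        by (field; lra).
      assert (0 <= b2) by (unfold b2; pose proof (Rle_0_sqr (Cre be)); pose proof (Rle_0_sqr (Cim be)); lra).
      nra. }
    assert (hb2 : 0 < b2) by nra.
    (* The scalar is [1 / be], as conjugate over squared modulus; it divides the form by [b2]. *)
    exists (vscal (mkCx (Cre be / b2) (- Cim be / b2)) x). repeat split.
    - now apply perp_scal.
    - rewrite inner_scal_l. fold be. unfold C1. apply Cx_eq; simpl.
      + unfold b2, Rsqr in *. field. lra.
      + unfold b2, Rsqr in *. field. lra.
    - rewrite A_vscal; simpl.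
      replace ((Cre be / b2)² + (- Cim be / b2)²) with (/ b2)
        by (unfold b2, Rsqr in *; field; lra).
      apply Rmult_le_reg_l with b2; auto. rewrite <- Rmult_assoc, Rinv_r, Rmult_1_l by lra.
      apply Rle_trans with (1 := qx). apply Rle_trans with (eta * dl * rin x x).
      + apply Rmult_le_compat_r; lra.
      + rewrite Rmult_assoc, (Rmult_comm b2). apply Rmult_le_compat_l; lra. }
  destruct (functional_choice (fun n f => perp L f /\ inner f a = C1 /\ rin (A f) f <= / INR (S n))) as [f hf].
  { intro n. apply F. apply Rinv_0_lt_compat, lt_0_INR; lia. }
  assert (small : forall e, 0 < e -> exists K, forall n, (n >= K)%nat -> rin (A (f n)) (f n) < e).
  { intros e hepos. destruct (archimed_cor1 e hepos) as (K & hK & hK0).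
    exists K; intros n hn. apply Rle_lt_trans with (/ INR (S n)); [apply hf|].
    apply Rle_lt_trans with (/ INR K); auto. apply Rinv_le_contravar.
    - now apply lt_0_INR.
    - apply le_INR; lia. }
  destruct (complete_sq f) as [l hl].
  { intros e hepos. destruct (small (e * eps / 4)) as [K hK]; [apply Rdiv_lt_0_compat; nra|].
    exists K; intros n m hn hm. pose proof (hK n hn). pose proof (hK m hm).
    assert (p : perp (a :: L) (vsub (f n) (f m))).
    { intros c [<-|hc].
      - rewrite vsub_rs, inner_add_l, inner_scal_l.
        destruct (hf n) as (_ & -> & _). destruct (hf m) as (_ & -> & _).
        apply Cx_eq; simpl; ring.
      - apply perp_sub with (L := L); auto; apply hf. }
    pose proof (coer _ p). pose proof (A_sub_le (f n) (f m)).
    apply Rmult_lt_reg_l with eps; lra. }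
  (* Cauchy-Schwarz for the form of [A] turns [<A (f n), f n> -> 0] into weak convergence of
     [A (f n)] to 0. *)
  assert (l0 : A l = vzero).
  { apply rin_ext; intro z. rewrite rin_0_l, A_sym.
    apply (UL_sequence (fun n => rin (f n) (A z))).
    - exact (vcv_rin _ _ _ hl).
    - intros e hepos. pose proof (A_pos z).
      destruct (small (e² / (rin (A z) z + 1))) as [K hK].
      { apply Rdiv_lt_0_compat; unfold Rsqr; nra. }
      exists K; intros n hn. specialize (hK n hn). unfold Rdist. rewrite Rminus_0_r, <- A_sym.
      rewrite <- (Rabs_pos_eq e) by lra. apply Rsqr_lt_abs_0.
      apply Rle_lt_trans with (1 := A_cs _ _). pose proof (A_pos (f n)).
      apply Rle_lt_trans with (rin (A (f n)) (f n) * (rin (A z) z + 1)); [lra|].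
      apply Rmult_lt_compat_r with (r := rin (A z) z + 1) in hK; [|lra].
      unfold Rdiv in hK. rewrite Rmult_assoc, Rinv_l, Rmult_1_r in hK; lra. }
  destruct HA as (_ & _ & _ & ker). apply ker in l0.
  assert (e : rin l a = 1).
  { apply (Un_cv_const_eq _ _ _ (vcv_rin _ _ a hl)). exists 0%nat; intros n _.
    destruct (hf n) as (_ & e & _). unfold rin. rewrite e. reflexivity. }
  rewrite l0, rin_0_l in e. lra.
Qed.

(** For the empty list, a positive lower bound of the form would make [A] onto by [coercive_onto];
    each further vector is handled by [small_vector_step], and scaling gives norm 1. *)
Lemma small_vector L : orthonormal L -> forall eps, 0 < eps ->
  exists x, perp L x /\ inner x x = C1 /\ rin (A x) x <= eps.
Proof.
  intros hL eps he.
  assert (S : forall eps, 0 < eps -> exists x, perp L x /\ 0 < rin x x /\ rin (A x) x <= eps * rin x x).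
  { clear eps he. induction L as [|a L IH].
    - intros eps he. apply NNPP; intro neg. destruct not_onto as [y hy]. apply hy.
      apply coercive_onto with eps; auto. intro x. pose proof (rin_pos x).
      destruct (Req_dec (rin x x) 0) as [e|ne]; [rewrite e; pose proof (A_pos x); lra|].
      apply Rnot_lt_le. intro lt. apply neg. exists x. repeat split; try lra. intros ? [].
    - destruct hL as (h1 & h2 & h3). apply small_vector_step; auto. }
  destruct (S eps he) as (x & px & nx & qx).
  exists (rs (/ sqrt (rin x x)) x).
  assert (hs : 0 < sqrt (rin x x)) by now apply sqrt_lt_R0.
  assert (hi : (/ sqrt (rin x x))² * rin x x = 1).
  { rewrite <- (sqrt_def (rin x x)) at 2 by lra. unfold Rsqr. field. lra. }
  repeat split.
  - now apply perp_scal.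
  - rewrite inner_rin, J_rs, !rin_rs_l, !rin_rs_r. unfold C1.
    assert (rin (J x) x = 0) by (pose proof (rin_J_r x x) as e; rewrite rin_sym in e; lra).
    rewrite H0. f_equal; [|ring]. unfold Rsqr in hi. lra.
  - unfold rs. rewrite A_vscal; simpl. unfold Rsqr at 2. rewrite Rmult_0_l, Rplus_0_r.
    pose proof (Rle_0_sqr (/ sqrt (rin x x))). set (i := (/ sqrt (rin x x))²) in *.
    apply Rmult_le_compat_l with (r := i) in qx; auto. nra.
Qed.

(** Gram-Schmidt: [r] is [d] minus its projection onto the span of [L], which vectors orthogonal to
    [L] cannot see. *)
Lemma residual L d : orthonormal L ->
  exists r, perp L r /\ forall v, perp L v -> inner v r = inner v d.
Proof.
  induction L as [|a L IH]; intro hL.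
  - exists d. split; auto. intros ? [].
  - destruct hL as (h1 & h2 & h3). destruct (IH h3) as (r & pr & er).
    exists (vsub r (vscal (inner r a) a)). split.
    + intros c [<-|hc]; [now apply inner_sub_proj|].
      apply perp_sub with (L := L); auto. apply perp_scal. exact h2.
    + intros v hv. rewrite <- er by (intros c hc; apply hv; now right).
      rewrite (inner_conj _ _ v), (inner_conj _ r v). f_equal.
      rewrite vsub_rs, inner_add_l, !inner_scal_l.
      rewrite (inner_conj _ v a), (hv a) by now left. apply Cx_eq; simpl; ring.
Qed.

(** [e] is the normalised residual of [d]. If that residual vanishes, [d] lies in the span of [L]
    and any unit vector orthogonal to [L] serves; [small_vector] provides one. *)
Lemma orthonormal_extend L d : orthonormal L ->
  exists e, perp L e /\ inner e e = C1 /\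
    forall v, perp L v -> inner v e = C0 -> inner v d = C0.
Proof.
  intro hL. destruct (residual L d hL) as (r & pr & er).
  destruct (classic (r = vzero)) as [->|nr].
  - destruct (small_vector L hL 1) as (e & pe & ne & _); [lra|].
    exists e. repeat split; auto. intros v hv _. rewrite <- er by auto.
    apply inner_C0_sym, inner_eq_C0. split; [apply rin_0_l|].
    pose proof (rin_J_r vzero v) as h. rewrite rin_0_l in h. lra.
  - assert (hr : 0 < rin r r).
    { destruct (rin_pos r) as [h|h]; auto. exfalso. apply nr, rin_self_0. auto. }
    assert (hs : 0 < sqrt (rin r r)) by now apply sqrt_lt_R0.
    exists (rs (/ sqrt (rin r r)) r). repeat split.
    + now apply perp_scal.
    + rewrite inner_rin, J_rs, !rin_rs_l, !rin_rs_r. unfold C1.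
      assert (z : rin (J r) r = 0) by (pose proof (rin_J_r r r) as e; rewrite rin_sym in e; lra).
      rewrite z. f_equal; [|ring].
      rewrite <- (sqrt_def (rin r r)) at 3 by lra. field. lra.
    + intros v hv o. rewrite <- er by auto. apply inner_eq_C0 in o as [o1 o2].
      rewrite rin_rs_r in o1, o2. apply inner_eq_C0.
      pose proof (Rinv_0_lt_compat _ hs).
      split; [apply Rmult_integral in o1|apply Rmult_integral in o2]; lra.
Qed.

Definition ortho_seq (b : nat -> H) : Prop :=
  forall i j, inner (b i) (b j) = if Nat.eq_dec i j then C1 else C0.
Definition total_seq (b : nat -> H) : Prop :=
  forall v, (forall n, inner v (b n) = C0) -> v = vzero.

(** A [d n] orthogonal to [v] is at distance at least [|v|] from [v]. *)
Lemma dense_orth_0 (d : nat -> H) :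
  (forall x eps, 0 < eps -> exists n, hnorm (vsub x (d n)) < eps) ->
  forall v, (forall n, inner v (d n) = C0) -> v = vzero.
Proof.
  intros hd v hv. apply rin_self_0. pose proof (rin_pos v) as p.
  destruct (Req_dec (rin v v) 0) as [e|ne]; auto. exfalso.
  destruct (hd v (sqrt (rin v v))) as [n hn]; [apply sqrt_lt_R0; lra|].
  apply hnorm_lt in hn; [|apply sqrt_lt_R0; lra].
  rewrite Rsqr_sqrt in hn by auto. pose proof (proj1 (proj1 (inner_eq_C0 _ _) (hv n))) as o.
  pose proof (rin_pos (d n)). revert hn. rin_simpl. rewrite (rin_sym (d n) v), o. lra.
Qed.

(* Even steps exhaust a dense sequence, odd steps insert vectors on which [A] is tiny. *)
Lemma adapted_basis (eps : nat -> R) : (forall n, 0 < eps n) ->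
  exists b : nat -> H, ortho_seq b /\ total_seq b /\
    forall n, Nat.odd n = true -> rin (A (b n)) (b n) <= eps n.
Proof.
  intro heps. destruct (separable H) as [d hd].
  (* The state is the list built so far with the step number [n]. The even clause says in dual form
     that [d (n / 2)] enters the span. *)
  destruct (functional_choice (fun (p : list H * nat) e => orthonormal (fst p) ->
     perp (fst p) e /\ inner e e = C1 /\
     (Nat.odd (snd p) = true -> rin (A e) e <= eps (snd p)) /\
     (Nat.even (snd p) = true -> forall v, perp (fst p) v -> inner v e = C0 ->
         inner v (d (Nat.div2 (snd p))) = C0))) as [next hnext].
  { intros [L n]; simpl. destruct (classic (orthonormal L)) as [hL|nL].
    - destruct (Nat.odd n) eqn:on.
      + destruct (small_vector L hL (eps n) (heps n)) as (e & h1 & h2 & h3).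
        exists e; intros _. repeat split; auto. rewrite <- Nat.negb_odd, on. discriminate.
      + destruct (orthonormal_extend L (d (Nat.div2 n)) hL) as (e & h1 & h2 & h3).
        exists e; intros _. repeat split; auto. discriminate.
    - exists vzero. intro; contradiction. }
  set (L := fix L n := match n with O => nil | S n => next (L n, n) :: L n end).
  set (b := fun n => next (L n, n)).
  assert (hL : forall n, orthonormal (L n)).
  { induction n; simpl; auto. destruct (hnext (L n, n) IHn) as (h1 & h2 & _). auto. }
  assert (inL : forall n m, (m < n)%nat -> In (b m) (L n)).
  { induction n; intros m hm; [lia|]. destruct (Nat.eq_dec m n) as [->|]; [now left|].
    right. apply IHn. lia. }
  assert (Lin : forall n x, In x (L n) -> exists m, (m < n)%nat /\ x = b m).
  { induction n; simpl; intros x []; [exists n; split; auto|].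
    destruct (IHn x H0) as (m & ? & ?). exists m; split; auto. }
  exists b. repeat split.
  - assert (lt : forall i j, (j < i)%nat -> inner (b i) (b j) = C0).
    { intros i j hij. apply (hnext (L i, i) (hL i)). now apply inL. }
    intros i j. destruct (Nat.eq_dec i j) as [->|ne].
    + apply (hnext (L j, j) (hL j)).
    + destruct (Nat.lt_gt_cases i j) as [h _]. destruct (h ne) as [l|l]; auto.
      now apply inner_C0_sym, lt.
  - intros v hv. apply (dense_orth_0 d hd). intro n.
    destruct (hnext (L (2 * n)%nat, (2 * n)%nat) (hL _)) as (_ & _ & _ & h).
    cbn [fst snd] in h. rewrite Nat.div2_double in h. apply h; auto.
    + now rewrite Nat.even_mul.
    + intros x hx. destruct (Lin _ _ hx) as (m & _ & ->). auto.
    + apply hv.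
  - intros n hn. now apply (hnext (L n, n) (hL n)).
Qed.

(** Moving [B] across the inner product and applying Cauchy-Schwarz gives [M = |z|^2]. The bound
    covers every [e], hence [J (b n)] as well as [b n]. *)
Lemma ran_sqrt_decay x : ran_sqrt A x ->
  exists M, 0 <= M /\ forall e, (rin x e)² <= M * rin (A e) e.
Proof.
  intros (B & ((lin & _) & sa & _ & sq) & z & <-).
  exists (rin z z). split; [apply rin_pos|]. intro e.
  assert (s : forall a c, rin (B a) c = rin a (B c)) by (intros a c; unfold rin; now rewrite sa).
  rewrite s, <- sq, s. apply cauchy_schwarz.
Qed.

End SmallVectors.

(** * Weighted forest *)

Definition sums (a : nat -> R) (l : R) : Prop := Un_cv (sum_f_R0 a) l.

Lemma sums_ext a a' l : (forall n, a n = a' n) -> sums a l -> sums a' l.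
Proof.
  intros e h eps he. destruct (h eps he) as [K hK]. exists K; intros n hn.
  rewrite <- (sum_eq a a' n); auto.
Qed.

Lemma sums_plus a a' l l' : sums a l -> sums a' l' -> sums (fun n => a n + a' n) (l + l').
Proof.
  intros h h' eps he. destruct (CV_plus _ _ _ _ h h' eps he) as [K hK].
  exists K; intros n hn. rewrite sum_plus. auto.
Qed.

Lemma sums_opp a l : sums a l -> sums (fun n => - a n) (- l).
Proof.
  intros h eps he. destruct (h eps he) as [K hK]. exists K; intros n hn.
  assert (e : sum_f_R0 (fun n => - a n) n = - sum_f_R0 a n).
  { clear. induction n; simpl; [|rewrite IHn]; ring. }
  specialize (hK n hn). unfold Rdist in *. rewrite e.
  replace (- sum_f_R0 a n - - l) with (- (sum_f_R0 a n - l)) by ring. now rewrite Rabs_Ropp.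
Qed.

Lemma sums_point j c : sums (fun n => if n =? j then c else 0) c.
Proof.
  assert (e : forall N, sum_f_R0 (fun n => if n =? j then c else 0) N = if j <=? N then c else 0).
  { induction N.
    - destruct j; reflexivity.
    - rewrite tech5, IHN. destruct (Nat.leb_spec j N), (Nat.eqb_spec (S N) j), (Nat.leb_spec j (S N));
        try lia; lra. }
  intros eps he. exists j; intros n hn. rewrite e.
  destruct (Nat.leb_spec j n); [|lia]. unfold Rdist. rewrite Rminus_diag, Rabs_R0. auto.
Qed.

(** * Geometric weights and the two-coloured forest *)

Open Scope bool_scope.
Definition w (n : nat) : R := (/ 4) ^ n.

Lemma w_pos n : 0 < w n.
Proof. apply pow_lt. lra. Qed.
Lemma w_antitone m n : (m <= n)%nat -> w n <= w m.
Proof.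
  induction 1; [lra|]. unfold w in *; simpl. pose proof (w_pos m0). unfold w in *. lra.
Qed.
Lemma w_le_1 n : w n <= 1.
Proof. apply (w_antitone 0 n). lia. Qed.
Lemma w_small eps : 0 < eps -> exists K, forall n, (n >= K)%nat -> w n < eps.
Proof.
  intro he. destruct (pow_lt_1_zero (/ 4) ltac:(rewrite Rabs_pos_eq; lra) eps he) as [K hK].
  exists K; intros n hn. specialize (hK n hn). rewrite Rabs_pos_eq in hK; auto.
  left; apply w_pos.
Qed.

Lemma le_w_zero a C : 0 <= C -> (forall K, exists n, (n >= K)%nat /\ Rabs a <= C * w n) -> a = 0.
Proof.
  intros hC h. apply NNPP. intro ne. pose proof (Rabs_pos_lt a ne).
  destruct (w_small (Rabs a / (C + 1))) as [K hK]; [apply Rdiv_lt_0_compat; lra|].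
  destruct (h K) as (n & hn & le). specialize (hK n hn).
  apply Rmult_lt_compat_r with (r := C + 1) in hK; [|lra].
  unfold Rdiv in hK. rewrite Rmult_assoc, Rinv_l, Rmult_1_r in hK by lra.
  pose proof (w_pos n). lra.
Qed.

(** The weights [4^-n] with [n >= 1] sum to 1/3; index 0 is nobody's child, so it can be left
    out. *)
Lemma sums_tail a l C : a 0%nat = 0 -> (forall n, Rabs (a n) <= C * w n) -> sums a l ->
  Rabs l <= C / 3.
Proof.
  intros a0 ha h.
  assert (b : forall N, Rabs (sum_f_R0 a N) <= C / 3 * (1 - w N)).
  { induction N; simpl sum_f_R0.
    - rewrite a0, Rabs_R0. unfold w; simpl. lra.
    - apply Rle_trans with (1 := Rabs_triang _ _). pose proof (ha (S N)) as h1.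
      unfold w in *; simpl in *. lra. }
  assert (hC : 0 <= C).
  { pose proof (ha 0%nat) as h1. rewrite a0, Rabs_R0 in h1. unfold w in h1; simpl in h1. lra. }
  apply Rnot_lt_le; intro lt. destruct (h (Rabs l - C / 3)) as [K hK]; [lra|].
  specialize (hK K (le_n K)). unfold Rdist in hK. pose proof (b K). pose proof (w_pos K).
  pose proof (Rabs_triang_inv l (sum_f_R0 a K)) as t. rewrite Rabs_minus_sym in t. nra.
Qed.

(* The odd index [2 * to_nat (p, y) + 1] is a child of [p], coloured by the parity of [y]; even
   indices are roots. *)
Definition child (m n : nat) : bool := Nat.odd n && (fst (of_nat (Nat.div2 n)) =? m).
Definition col (n : nat) : bool := Nat.odd (snd (of_nat (Nat.div2 n))).

Lemma child_odd m n : child m n = true -> Nat.odd n = true.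
Proof. unfold child. now intros [h _]%andb_prop. Qed.

Lemma child_inj m m' n : child m n = true -> child m' n = true -> m = m'.
Proof.
  unfold child. intros [_ h]%andb_prop [_ h']%andb_prop.
  apply Nat.eqb_eq in h, h'. congruence.
Qed.

Lemma child_lt m n : child m n = true -> (m < n)%nat.
Proof.
  unfold child. intros [o h]%andb_prop. apply Nat.eqb_eq in h.
  pose proof (to_nat_non_decreasing (fst (of_nat (Nat.div2 n))) (snd (of_nat (Nat.div2 n)))) as le.
  rewrite <- surjective_pairing, cancel_to_of in le.
  pose proof (Nat.div2_odd n) as e. rewrite o in e. simpl in e. lia.
Qed.

Lemma child_far m k K : exists n, (n >= K)%nat /\ child m n = true /\ col n = k.
Proof.
  (* The summand [2 * K] pushes the index past [K]; the parity of [y] fixes the colour. *)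
  set (y := (2 * K + Nat.b2n k)%nat). set (s := to_nat (m, y)).
  assert (e : Nat.div2 (2 * s + 1) = s).
  { rewrite Nat.add_1_r. apply Nat.div2_succ_double. }
  exists (2 * s + 1)%nat. split; [|split].
  - pose proof (to_nat_non_decreasing m y). fold s in H. unfold y in *. lia.
  - unfold child. rewrite e. unfold s at 2. rewrite cancel_of_to. simpl fst.
    rewrite Nat.eqb_refl, Nat.odd_add, Nat.odd_mul. reflexivity.
  - unfold col. rewrite e. unfold s. rewrite cancel_of_to. simpl snd. unfold y.
    rewrite Nat.odd_add, Nat.odd_mul. destruct k; reflexivity.
Qed.

(** The symmetric weighted adjacency matrix of the forest; an edge has the weight of its child
    end. *)
Definition edge (m n : nat) : R :=
  (if child m n then w n else 0) + (if child n m then w m else 0).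

(** Coordinates of [b j] plus [s] times the part of row [j] of [edge] in the colour other than [k].
    For [j] of colour [k], the parameters [true, 1] give generators of the graph of [T], and
    [false, -1] those of its complement. *)
Definition phi (k : bool) (s : R) (j n : nat) : R :=
  (if n =? j then 1 else 0) + (if Bool.eqb (col n) k then 0 else s * edge j n).

Definition gam (i n : nat) : R :=
  (if n =? i then 1 else 0) + (if col n && child i n then w n else 0).

Lemma edge_sym m n : edge m n = edge n m.
Proof. unfold edge. ring. Qed.

Lemma edge_bound m n : 0 <= edge m n <= 2 * w n.
Proof.
  unfold edge. pose proof (w_pos n). pose proof (w_pos m).
  destruct (child m n); destruct (child n m) eqn:e; try lra;
  pose proof (w_antitone n m (Nat.lt_le_incl _ _ (child_lt _ _ e))); lra.
Qed.

Definition decaying (f : nat -> R) : Prop := exists C, forall n, Rabs (f n) <= C * w n.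

Lemma point_bound j n : Rabs (if n =? j then 1 else 0) <= / w j * w n.
Proof.
  pose proof (w_pos n). pose proof (w_pos j). destruct (Nat.eqb_spec n j) as [->|].
  - rewrite Rabs_R1, Rinv_l; lra.
  - rewrite Rabs_R0. pose proof (Rinv_0_lt_compat (w j)). nra.
Qed.

Lemma phi_decaying k s j : decaying (phi k s j).
Proof.
  exists (/ w j + 2 * Rabs s). intro n. unfold phi.
  apply Rle_trans with (1 := Rabs_triang _ _). pose proof (point_bound j n).
  enough (Rabs (if Bool.eqb (col n) k then 0 else s * edge j n) <= 2 * Rabs s * w n) by lra.
  pose proof (w_pos n). pose proof (Rabs_pos s). destruct (Bool.eqb (col n) k).
  - rewrite Rabs_R0. nra.
  - pose proof (edge_bound j n). rewrite Rabs_mult, (Rabs_pos_eq (edge j n)) by lra. nra.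
Qed.

Lemma gam_decaying i : decaying (gam i).
Proof.
  exists (/ w i + 1). intro n. unfold gam.
  apply Rle_trans with (1 := Rabs_triang _ _). pose proof (point_bound i n).
  pose proof (w_pos n).
  enough (Rabs (if col n && child i n then w n else 0) <= w n) by lra.
  destruct (col n && child i n); [rewrite Rabs_pos_eq|rewrite Rabs_R0]; lra.
Qed.

(** * Series against rapidly decreasing or bounded sequences *)

Definition rapid_seq (M : R) (u : nat -> R) : Prop :=
  0 <= M /\ forall n, Nat.odd n = true -> Rabs (u n) <= M * (w n * w n).

(* On a rapid sequence, [phi] at the vertex [q] only sees [q] and its parent [p]: the
   contribution of the children of [q] is of lower order than the weight of the edge [p q]. *)
Lemma phi_sums_asymptotic k s M u p q l :
  Rabs s <= 1 -> rapid_seq M u -> child p q = true ->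
  sums (fun n => phi k s q n * u n) l ->
  Rabs (l - (u q + if Bool.eqb (col p) k then 0 else s * w q * u p)) <= M * (w q * w q) / 3.
Proof.
  intros hs [hM hu] hpq hl.
  set (cp := if Bool.eqb (col p) k then 0 else s * w q * u p).
  (* The children [n] of [q] satisfy [w n <= w q], so each of these terms is at most
     [M * (w q * w q) * w n]. *)
  set (rest := fun n => if Bool.eqb (col n) k then 0 else if child q n then s * w n * u n else 0).
  apply (sums_tail rest).
  - unfold rest. destruct (Bool.eqb (col 0) k); auto.
  - intro n. pose proof (w_pos n). pose proof (w_pos q).
    assert (pos : 0 <= M * (w q * w q) * w n).
    { repeat apply Rmult_le_pos; lra. }
    unfold rest. destruct (Bool.eqb (col n) k); [now rewrite Rabs_R0|].
    destruct (child q n) eqn:e; [|now rewrite Rabs_R0].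
    pose proof (hu n (child_odd _ _ e)) as b.
    pose proof (w_antitone q n (Nat.lt_le_incl _ _ (child_lt _ _ e))).
    rewrite !Rabs_mult, (Rabs_pos_eq (w n)) by lra.
    pose proof (Rabs_pos s). pose proof (Rabs_pos (u n)).
    apply Rle_trans with (1 * w n * (M * (w n * w n))).
    + apply Rmult_le_compat; auto; [apply Rmult_le_pos; lra|]. apply Rmult_le_compat_r; lra.
    + rewrite Rmult_1_l, Rmult_comm. apply Rmult_le_compat_r; [lra|].
      apply Rmult_le_compat_l; auto. apply Rmult_le_compat; lra.
  - replace (l - (u q + cp)) with (l + - (u q + cp)) by ring.
    refine (sums_ext _ _ _ _ (sums_plus _ _ _ _ hl (sums_opp _ _
              (sums_plus _ _ _ _ (sums_point q (u q)) (sums_point p cp))))).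
    intro n. cbv beta. unfold phi, rest, edge.
    pose proof (child_lt _ _ hpq).
    assert (e : child n q = (n =? p)).
    { destruct (Nat.eqb_spec n p) as [->|ne]; auto.
      destruct (child n q) eqn:e; auto. destruct ne. now apply child_inj with q. }
    rewrite e. destruct (Nat.eqb_spec n p) as [->|np].
    + destruct (Nat.eqb_spec p q); [lia|].
      assert (e' : child q p = false).
      { destruct (child q p) eqn:e'; auto. apply child_lt in e'. lia. }
      rewrite e'. unfold cp. destruct (Bool.eqb (col p) k); ring.
    + destruct (Nat.eqb_spec n q) as [->|].
      * rewrite e. destruct (Bool.eqb (col q) k); ring.
      * destruct (Bool.eqb (col n) k), (child q n); ring.
Qed.

(** The off-diagonal entries of [phi] lie on the colour other than [k], where [u] vanishes. *)
Lemma phi_sums_diag k s u j l : (forall n, col n = negb k -> u n = 0) ->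
  sums (fun n => phi k s j n * u n) l -> l = u j.
Proof.
  intros hu hl. apply (UL_sequence _ _ _ hl).
  refine (sums_ext _ _ _ _ (sums_point j (u j))). intro n. unfold phi.
  destruct (Bool.eqb (col n) k) eqn:e.
  - destruct (Nat.eqb_spec n j) as [->|]; ring.
  - assert (z : u n = 0) by (apply hu; destruct (col n), k; auto; discriminate).
    destruct (Nat.eqb_spec n j) as [->|]; rewrite z; ring.
Qed.

(** A coordinate [u c] of the other colour is read off at a child [q] of [c] of colour [k]: there
    [w q * u c] is of order [w q * w q], so [u c = O(w q)] with [q] arbitrarily large. The colour
    [k] then follows from [phi_sums_diag]. *)
Lemma phi_separates k s M u : Rabs s = 1 -> rapid_seq M u ->
  (forall j, col j = k -> sums (fun n => phi k s j n * u n) 0) -> forall n, u n = 0.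
Proof.
  intros hs hu h.
  assert (off : forall c, col c = negb k -> u c = 0).
  { intros c hc. apply (le_w_zero _ (2 * M)); [destruct hu; lra|]. intro K.
    destruct (child_far c k K) as (q & hq & hcq & kq). exists q; split; auto.
    pose proof (phi_sums_asymptotic k s M u c q 0 ltac:(lra) hu hcq (h q kq)) as b.
    replace (Bool.eqb (col c) k) with false in b by (rewrite hc; destruct k; auto).
    destruct hu as [hM hu]. pose proof (hu q (child_odd _ _ hcq)) as bq.
    pose proof (w_pos q).
    assert (t : Rabs (s * w q * u c) <= 2 * M * (w q * w q)).
    { replace (s * w q * u c) with (- (0 - (u q + s * w q * u c)) - u q) by ring.
      apply Rle_trans with (1 := Rabs_triang _ _). rewrite !Rabs_Ropp.
      assert (0 <= M * (w q * w q)) by (repeat apply Rmult_le_pos; lra). lra. }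
    rewrite !Rabs_mult, hs, (Rabs_pos_eq (w q)) in t by lra.
    apply Rmult_le_reg_l with (w q); auto. lra. }
  intro n. destruct (Bool.bool_dec (col n) k) as [e|e].
  - symmetry. now apply (phi_sums_diag k s u n 0 off), h.
  - apply off. destruct (col n), k; auto; congruence.
Qed.

(** Dual form of the density of the span of the [gamma i] in [X]. The entries of [gam i] at the
    children of [i] sum to at most 1/3, against 1 at [i] itself. *)
Lemma gam_separates S u : (forall n, Rabs (u n) <= S) ->
  (forall i, col i = true -> sums (fun n => gam i n * u n) 0) -> forall n, col n = true -> u n = 0.
Proof.
  intros hS h.
  assert (hS0 : 0 <= S) by (pose proof (hS 0%nat); pose proof (Rabs_pos (u 0%nat)); lra).
  (* [gam] bounds the supremum of [|u|] over one colour class by a third of itself. *)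
  assert (contr : forall m i, col i = true -> Rabs (u i) <= S * (/ 3) ^ m).
  { intro m; induction m as [|m IH]; intros i hi; [simpl; rewrite Rmult_1_r; auto|].
    pose proof (pow_le (/ 3) m ltac:(lra)) as p.
    set (rest := fun n => if col n && child i n then w n * u n else 0).
    assert (b : Rabs (- u i) <= S * (/ 3) ^ m / 3).
    { apply (sums_tail rest).
      - unfold rest. now rewrite Bool.andb_false_r.
      - intro n. pose proof (w_pos n). unfold rest.
        destruct (col n && child i n) eqn:e.
        + apply andb_prop in e as [e _]. rewrite Rabs_mult, (Rabs_pos_eq (w n)) by lra.
          rewrite Rmult_comm. apply Rmult_le_compat_r; [lra|auto].
        + rewrite Rabs_R0. repeat apply Rmult_le_pos; lra.
      - replace (- u i) with (0 + - u i) by ring.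
        refine (sums_ext _ _ _ _ (sums_plus _ _ _ _ (h i hi) (sums_opp _ _ (sums_point i (u i))))).
        intro n. cbv beta. unfold gam, rest.
        destruct (Nat.eqb_spec n i) as [->|]; destruct (col _ && child i _); ring. }
    rewrite Rabs_Ropp in b. simpl. lra. }
  intros n hn. apply NNPP; intro ne. pose proof (Rabs_pos_lt _ ne) as pos.
  destruct (pow_lt_1_zero (/ 3) ltac:(rewrite Rabs_pos_eq; lra) (Rabs (u n) / (S + 1))) as [K hK].
  { apply Rdiv_lt_0_compat; lra. }
  specialize (hK K (le_n K)). pose proof (contr K n hn). pose proof (pow_le (/ 3) K ltac:(lra)).
  rewrite Rabs_pos_eq in hK by auto.
  apply Rmult_lt_compat_r with (r := S + 1) in hK; [|lra].
  unfold Rdiv in hK. rewrite Rmult_assoc, Rinv_l, Rmult_1_r in hK; lra.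
Qed.

(** * The subspaces *)

Section Synthesis.
Context {H : Hilbert} (b : nat -> H) (Hb : ortho_seq b) (Ht : total_seq b).

Lemma rin_basis i j : rin (b i) (b j) = if i =? j then 1 else 0.
Proof.
  unfold rin. rewrite Hb. destruct (Nat.eq_dec i j), (Nat.eqb_spec i j); try lia; reflexivity.
Qed.
Lemma rin_J_basis i j : rin (J (b i)) (b j) = 0.
Proof.
  pose proof (inner_rin (b i) (b j)) as e. rewrite Hb in e.
  destruct (Nat.eq_dec i j); apply (f_equal Cim) in e; simpl in e; lra.
Qed.

Lemma total_real v : (forall n, rin v (b n) = 0) -> (forall n, rin (J v) (b n) = 0) -> v = vzero.
Proof. intros h1 h2. apply Ht. intro n. apply inner_eq_C0; auto. Qed.

Fixpoint psum (f : nat -> R) (n : nat) : H :=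
  match n with
  | O => rs (f O) (b O)
  | S n => vadd (psum f n) (rs (f (S n)) (b (S n)))
  end.

Lemma rin_psum f n v : rin v (psum f n) = sum_f_R0 (fun i => f i * rin v (b i)) n.
Proof. induction n; simpl; rin_simpl; [|rewrite IHn]; reflexivity. Qed.

Lemma psum_orth f n m : (n < m)%nat -> rin (psum f n) (b m) = 0.
Proof.
  intro h. induction n; simpl; rin_simpl; rewrite ?IHn by lia; rewrite rin_basis.
  - destruct (Nat.eqb_spec 0 m); [lia|ring].
  - destruct (Nat.eqb_spec (S n) m); [lia|ring].
Qed.

(** Riesz-Fischer for exponentially decaying coefficients: [w (S n) * w (S n) <= w n - w (S n)]
    makes the bound on the squared tails telescope. *)
Lemma synthesis f : decaying f ->
  exists x, forall v, sums (fun n => f n * rin v (b n)) (rin v x).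
Proof.
  intros [C hf].
  assert (bound : forall m p,
    rin (vsub (psum f (m + p)) (psum f m)) (vsub (psum f (m + p)) (psum f m))
      <= C² * (w m - w (m + p))).
  { intros m p; induction p.
    - rewrite Nat.add_0_r. rin_simpl. lra.
    - rewrite Nat.add_succ_r. cbn [psum]. set (n := (m + p)%nat) in *.
      assert (e : vsub (vadd (psum f n) (rs (f (S n)) (b (S n)))) (psum f m)
                = vadd (vsub (psum f n) (psum f m)) (rs (f (S n)) (b (S n)))).
      { apply rin_ext; intro z; rin_simpl; ring. }
      rewrite e. clear e. set (D := vsub (psum f n) (psum f m)) in *.
      assert (o : rin D (b (S n)) = 0).
      { unfold D. rewrite rin_sub_l, !psum_orth by (unfold n; lia). ring. }
      rewrite rin_add_l, !rin_add_r, !rin_rs_l, !rin_rs_r, (rin_sym (b (S n)) D), o, rin_basis,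
        Nat.eqb_refl.
      assert (q : (f (S n))² <= C² * (w (S n) * w (S n))).
      { pose proof (hf (S n)) as h. pose proof (Rabs_pos (f (S n))).
        rewrite Rsqr_abs. unfold Rsqr. nra. }
      assert (g : w (S n) * w (S n) <= w n - w (S n)).
      { pose proof (w_pos n). pose proof (w_le_1 n). unfold w in *; simpl. nra. }
      pose proof (Rle_0_sqr C). unfold Rsqr at 1 in q. nra. }
  destruct (complete_sq (psum f)) as [x hx].
  { intros eps he. destruct (w_small (eps / (C² + 1))) as [K hK].
    { pose proof (Rle_0_sqr C). apply Rdiv_lt_0_compat; lra. }
    assert (ordered : forall n m, (n >= m)%nat -> (m >= K)%nat ->
      rin (vsub (psum f n) (psum f m)) (vsub (psum f n) (psum f m)) < eps).
    { intros n m hn hm. replace n with (m + (n - m))%nat by lia.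
      apply Rle_lt_trans with (1 := bound _ _). specialize (hK m hm).
      pose proof (Rle_0_sqr C). pose proof (w_pos (m + (n - m))). pose proof (w_pos m).
      apply Rmult_lt_compat_r with (r := C² + 1) in hK; [|lra].
      unfold Rdiv in hK. rewrite Rmult_assoc, Rinv_l, Rmult_1_r in hK by lra. nra. }
    exists K; intros n m hn hm. destruct (Nat.le_ge_cases m n); [apply ordered; auto|].
    replace (rin (vsub (psum f n) (psum f m)) (vsub (psum f n) (psum f m)))
      with (rin (vsub (psum f m) (psum f n)) (vsub (psum f m) (psum f n))) by (rin_simpl; ring).
    apply ordered; auto. }
  exists x. intro v. pose proof (vcv_rin _ _ v hx) as c. intros eps he.
  destruct (c eps he) as [K hK]. exists K; intros n hn.
  rewrite <- rin_psum, (rin_sym v), (rin_sym v). auto.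
Qed.

Context (vec : (nat -> R) -> H)
  (vec_spec : forall f, decaying f -> forall v, sums (fun n => f n * rin v (b n)) (rin v (vec f))).

Lemma rin_vec_basis f m : decaying f -> rin (vec f) (b m) = f m.
Proof.
  intro h. rewrite rin_sym. apply (UL_sequence _ _ _ (vec_spec f h (b m))).
  refine (sums_ext _ _ _ _ (sums_point m (f m))). intro n. rewrite rin_basis, Nat.eqb_sym.
  destruct (Nat.eqb_spec m n) as [->|]; ring.
Qed.

Lemma rin_J_vec_basis f m : decaying f -> rin (J (vec f)) (b m) = 0.
Proof.
  intro h. rewrite rin_sym, rin_J_r.
  enough (e : rin (J (b m)) (vec f) = 0) by lra.
  apply (UL_sequence _ _ _ (vec_spec f h (J (b m)))).
  refine (sums_ext _ _ _ _ (sums_point 0 0)). intro n. rewrite rin_J_basis.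
  destruct (n =? 0); ring.
Qed.

(** Parseval's identity; real coefficients leave no imaginary part. *)
Lemma inner_vec f g s : decaying f -> decaying g -> sums (fun n => g n * f n) s ->
  inner (vec f) (vec g) = mkCx s 0.
Proof.
  intros hf hg hs. rewrite inner_rin. f_equal.
  - apply (UL_sequence _ _ _ (vec_spec g hg (vec f))).
    refine (sums_ext _ _ _ _ hs). intro n. now rewrite rin_vec_basis.
  - enough (e : rin (J (vec f)) (vec g) = 0) by lra.
    apply (UL_sequence _ _ _ (vec_spec g hg (J (vec f)))).
    refine (sums_ext _ _ _ _ (sums_point 0 0)). intro n. rewrite rin_J_vec_basis by auto.
    destruct (n =? 0); ring.
Qed.

(** For [c] in [Y], this is [b c] minus its image under the transpose of [T], a vector orthogonal to
    the graph. *)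
Definition tau (c : nat) : H := vec (phi false (-1) c).
Definition graph (j : nat) : H := vec (phi true 1 j).
Definition gamma (i : nat) : H := vec (gam i).

(** Only the indices [j] and [c] contribute; the symmetry of [edge] and the opposite signs of [s]
    cancel them. *)
Lemma inner_graph_tau j c : col j = true -> col c = false -> inner (graph j) (tau c) = C0.
Proof.
  intros hj hc. apply inner_vec; try apply phi_decaying.
  replace 0 with (- edge c j + edge j c) by (rewrite edge_sym; ring).
  refine (sums_ext _ _ _ _ (sums_plus _ _ _ _ (sums_point j _) (sums_point c _))).
  intro n. cbv beta. unfold phi.
  destruct (Nat.eqb_spec n j) as [->|nj]; [|destruct (Nat.eqb_spec n c) as [->|nc]].
  - destruct (Nat.eqb_spec j c); [congruence|]. rewrite hj. simpl. ring.
  - rewrite hc. simpl. ring.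
  - destruct (col n); simpl; ring.
Qed.

(** [gamma i] is supported on the colour of [X], where [graph j] has the single entry 1 at [j]. *)
Lemma inner_graph_gamma j i : col j = true -> col i = true ->
  inner (graph j) (gamma i) = mkCx (gam i j) 0.
Proof.
  intros hj hi. apply inner_vec; auto using phi_decaying, gam_decaying.
  refine (sums_ext _ _ _ _ (sums_point j _)).
  intro n. cbv beta. unfold phi.
  destruct (Nat.eqb_spec n j) as [->|].
  - rewrite hj. simpl. ring.
  - destruct (col n) eqn:e; simpl; [ring|]. unfold gam. rewrite e.
    destruct (Nat.eqb_spec n i) as [->|]; [congruence|]. simpl. ring.
Qed.

(** Orthogonality to the [tau c] describes the graph of [T], which is then cut by the first
    [gamma i]. This decreases with [k], and its complement is [N k]. *)
Definition graph_part (k : nat) (x : H) : Prop :=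
  (forall c, col c = false -> inner x (tau c) = C0) /\
  (forall i, (i < k)%nat -> col i = true -> inner x (gamma i) = C0).

Definition rapid (v : H) : Prop :=
  exists M, rapid_seq M (fun n => rin v (b n)) /\ rapid_seq M (fun n => rin (J v) (b n)).

(** The off-diagonal part of [graph q] omits the colour of the parent [p], so no term of order [w q]
    arises. *)
Lemma graph_bound M u v q p : rapid_seq M (fun n => rin v (b n)) -> u = rin v (graph q) ->
  child p q = true -> col p = true -> Rabs u <= 2 * M * (w q * w q).
Proof.
  intros hv -> hpq hp.
  pose proof (phi_sums_asymptotic true 1 M _ p q _ ltac:(rewrite Rabs_R1; lra) hv hpq
    (vec_spec _ (phi_decaying _ _ _) v)) as a.
  rewrite hp in a. simpl in a. fold (graph q) in a. destruct hv as [hM hv].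
  pose proof (hv q (child_odd _ _ hpq)) as h. cbv beta in h.
  replace (rin v (graph q)) with ((rin v (graph q) - (rin v (b q) + 0)) + rin v (b q)) by ring.
  apply Rle_trans with (1 := Rabs_triang _ _).
  pose proof (w_pos q). assert (0 <= M * (w q * w q)) by (repeat apply Rmult_le_pos; lra). lra.
Qed.

(* Given [x] in [graph_part k], a multiple of [graph q], for a child [q] of [k] far out, corrects
   it into [graph_part (S k)]; [v], being rapid, does not see the correction in the limit. *)
Lemma orth_graph_part_descend k v : rapid v -> orth (graph_part (S k)) v -> orth (graph_part k) v.
Proof.
  intros (M & hv & hJv) ho x hx.
  destruct (col k) eqn:ck.
  (* For [k] outside [X] no condition is added, and [graph_part] stays the same. *)
  2:{ apply ho. destruct hx as [h1 h2]. split; auto. intros i hi ci.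
      destruct (Nat.eq_dec i k) as [->|]; [congruence|apply h2; auto; lia]. }
  set (a := inner x (gamma k)).
  assert (hM : 0 <= M) by apply hv.
  assert (key : forall K, exists q, (q >= K)%nat /\
     Rabs (rin v x) <= (Rabs (Cre a) + Rabs (Cim a)) * (2 * M) * w q /\
     Rabs (rin (J v) x) <= (Rabs (Cre a) + Rabs (Cim a)) * (2 * M) * w q).
  (* [q > k] keeps the entry 1 of each [gam i] with [i <= k] away from [q]. *)
  { intro K. destruct (child_far k true (K + S k)) as (q & hq & hkq & cq).
    exists q; split; [lia|].
    pose proof (w_pos q) as wq.
    assert (gq : forall i, (i <= k)%nat -> gam i q = if i =? k then w q else 0).
    { intros i hi. unfold gam. rewrite cq. destruct (Nat.eqb_spec q i); [lia|].
      destruct (Nat.eqb_spec i k) as [->|ne]; [rewrite hkq; simpl; ring|].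
      destruct (child i q) eqn:e; [|simpl; ring]. destruct ne. now apply child_inj with q. }
    (* This is [- a / w q], since [graph q] and [gamma k] pair to [w q]. The factor [1 / w q] will
       meet a pairing with [v] of order [w q * w q]. *)
    set (t := mkCx (- Cre a / w q) (- Cim a / w q)).
    set (x' := vadd x (vscal t (graph q))).
    assert (zx : graph_part (S k) x').
    { split.
      - intros c hc. unfold x'. rewrite inner_add_l, inner_scal_l, inner_graph_tau by auto.
        rewrite (proj1 hx) by auto. apply Cx_eq; simpl; ring.
      - intros i hi ci. unfold x'. rewrite inner_add_l, inner_scal_l, inner_graph_gamma by auto.
        rewrite gq by lia. destruct (Nat.eqb_spec i k) as [->|].
        + fold a. apply Cx_eq; simpl; field; lra.
        + rewrite (proj2 hx) by (auto; lia). apply Cx_eq; simpl; ring. }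
    pose proof (ho x' zx) as o. apply inner_eq_C0 in o as [o1 o2].
    unfold x' in o1, o2. rewrite vscal_split in o1, o2. unfold t in o1, o2.
    cbn [Cre Cim] in o1, o2. revert o1 o2. rin_simpl. intros o1 o2.
    pose proof (graph_bound M _ v q k hv eq_refl hkq ck) as g1.
    pose proof (graph_bound M _ (J v) q k hJv eq_refl hkq ck) as g2.
    set (y1 := rin v (graph q)) in *. set (y2 := rin (J v) (graph q)) in *.
    assert (comb : forall r s z1 z2 l,
      Rabs z1 <= 2 * M * (w q * w q) -> Rabs z2 <= 2 * M * (w q * w q) ->
      l = r / w q * z1 + s / w q * z2 -> Rabs l <= (Rabs r + Rabs s) * (2 * M) * w q).
    { intros r s z1 z2 l b1 b2 ->. apply Rle_trans with (1 := Rabs_triang _ _).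
      unfold Rdiv. rewrite !Rabs_mult, (Rabs_pos_eq (/ w q)) by (left; now apply Rinv_0_lt_compat).
      replace ((Rabs r + Rabs s) * (2 * M) * w q) with
        (Rabs r * / w q * (2 * M * (w q * w q)) + Rabs s * / w q * (2 * M * (w q * w q)))
        by (field; lra).
      pose proof (Rinv_0_lt_compat _ wq).
      apply Rplus_le_compat; apply Rmult_le_compat_l; auto; apply Rmult_le_pos;
        auto using Rabs_pos; lra. }
    split.
    - rewrite <- (Rabs_Ropp (Cim a)). apply (comb _ _ y1 y2); auto. unfold Rdiv in *. lra.
    - rewrite (Rplus_comm (Rabs (Cre a))). apply (comb _ _ y1 y2); auto. unfold Rdiv in *. lra. }
  assert (hC : 0 <= (Rabs (Cre a) + Rabs (Cim a)) * (2 * M)).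
  { pose proof (Rabs_pos (Cre a)). pose proof (Rabs_pos (Cim a)). apply Rmult_le_pos; lra. }
  apply inner_eq_C0; split; apply (le_w_zero _ _ hC); intro K;
    destruct (key K) as (q & ? & ? & ?); exists q; auto.
Qed.

(** * Triviality of the intersections *)

Lemma sums_vec0 f v : decaying f -> rin v (vec f) = 0 -> sums (fun n => f n * rin v (b n)) 0.
Proof. intros hf <-. now apply vec_spec. Qed.

Lemma rapid_perp_phi k s v : rapid v -> Rabs s = 1 ->
  (forall j, col j = k -> inner v (vec (phi k s j)) = C0) -> v = vzero.
Proof.
  intros (M & h1 & h2) hs ho.
  apply total_real; [apply (phi_separates k s M _ hs h1)|apply (phi_separates k s M _ hs h2)];
    intros j hj; apply sums_vec0; auto using phi_decaying; now apply inner_eq_C0, ho.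
Qed.

(** Descent leads to [k = 0], where every [graph j] with [j] in [X] lies in [graph_part 0], and
    these separate rapid vectors. *)
Lemma orth_graph_part_rapid k v : rapid v -> orth (graph_part k) v -> v = vzero.
Proof.
  intros hr. induction k; intro ho.
  - apply (rapid_perp_phi true 1); auto using Rabs_R1.
    intros j hj. apply ho. split; [|intros; lia]. intros c hc. now apply inner_graph_tau.
  - apply IHk. now apply orth_graph_part_descend.
Qed.

Lemma orth_orth_tau k v c : orth (orth (graph_part k)) v -> col c = false -> inner v (tau c) = C0.
Proof. intros ho hc. apply ho. intros x hx. apply inner_C0_sym. now apply hx. Qed.

Lemma orth_orth_gamma k v i : orth (orth (graph_part k)) v -> (i < k)%nat -> col i = true ->
  inner v (gamma i) = C0.
Proof. intros ho hi ci. apply ho. intros x hx. apply inner_C0_sym. now apply hx. Qed.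

(** The complement of [N k] is orthogonal to every [tau c] with [c] in [Y], and these separate rapid
    vectors. *)
Lemma orth_orth_graph_part_rapid k v : rapid v -> orth (orth (graph_part k)) v -> v = vzero.
Proof.
  intros hr ho. apply (rapid_perp_phi false (-1)); auto.
  - rewrite Rabs_left; lra.
  - intros c hc. now apply orth_orth_tau with k.
Qed.

Lemma coord_bounded v n : Rabs (rin v (b n)) <= rin v v + 1.
Proof.
  pose proof (cauchy_schwarz v (b n)) as cs. rewrite rin_basis, Nat.eqb_refl, Rmult_1_r in cs.
  pose proof (rin_pos v). rewrite <- (Rabs_pos_eq (rin v v + 1)) by lra.
  apply Rsqr_le_abs_0. unfold Rsqr in *. nra.
Qed.

(** The [gamma i] first annihilate the coordinates in [X]; after that, pairing with [tau c] returns
    the coordinate at [c]. *)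
Lemma perp_all_coord v :
  (forall c, col c = false -> rin v (tau c) = 0) ->
  (forall i, col i = true -> rin v (gamma i) = 0) -> forall n, rin v (b n) = 0.
Proof.
  intros ht hg.
  assert (ev : forall n, col n = true -> rin v (b n) = 0).
  { apply (gam_separates (rin v v + 1) (fun n => rin v (b n))).
    - intro n. apply coord_bounded.
    - intros i hi. apply sums_vec0; auto using gam_decaying. now apply hg. }
  intro n. destruct (col n) eqn:e; auto.
  symmetry. apply (phi_sums_diag false (-1) (fun n => rin v (b n)) n 0 ev).
  apply sums_vec0; auto using phi_decaying. now apply ht.
Qed.

Lemma orth_orth_graph_part_all v : (forall k, orth (orth (graph_part k)) v) -> v = vzero.
Proof.
  intro h. apply total_real; apply perp_all_coord.
  - intros c hc. now apply inner_eq_C0, (orth_orth_tau 0).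
  - intros i hi. apply inner_eq_C0, (orth_orth_gamma (S i)); auto.
  - intros c hc. now apply inner_eq_C0, (orth_orth_tau 0).
  - intros i hi. apply inner_eq_C0, (orth_orth_gamma (S i)); auto.
Qed.

End Synthesis.

(** * Decay on the range of the square root, and conclusion *)

Lemma ran_sqrt_rapid {H : Hilbert} (A : H -> H) (HA : B0plus A) (b : nat -> H) :
  (forall n, Nat.odd n = true -> rin (A (b n)) (b n) <= (w n * w n)²) ->
  forall x, ran_sqrt A x -> rapid b x.
Proof.
  intros hb x hx. destruct (ran_sqrt_decay A x hx) as (M & hM & dec).
  assert (bd : forall n l, Nat.odd n = true -> l² <= M * rin (A (b n)) (b n) ->
    Rabs l <= sqrt M * (w n * w n)).
  { intros n l hn hl. pose proof (w_pos n). pose proof (sqrt_pos M).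
    assert (0 <= sqrt M * (w n * w n)) by (repeat apply Rmult_le_pos; lra).
    rewrite <- (Rabs_pos_eq (sqrt M * (w n * w n))) by auto. apply Rsqr_le_abs_0.
    rewrite Rsqr_mult, Rsqr_sqrt by auto. apply Rle_trans with (1 := hl).
    apply Rmult_le_compat_l; auto. }
  exists (sqrt M). split; split; try apply sqrt_pos; intros n hn; apply bd; auto.
  (* Multiplication by i preserves the form of [A], so imaginary parts obey the same bound. *)
  replace (rin (J x) (b n)) with (- rin x (J (b n))) by (rin_simpl; ring).
  rewrite <- Rsqr_neg. apply Rle_trans with (1 := dec _). right. f_equal.
  unfold J. rewrite (A_vscal A HA). simpl. unfold Rsqr. ring.
Qed.

Theorem theorem3p9 (H : Hilbert) (A : H -> H) :
  B0plus A ->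
  (exists y : H, ~ ran A y) ->
  exists N : nat -> (H -> Prop),
    (forall k, subspace (N k)) /\
    (forall k x, N k x -> N (S k) x) /\
    (forall k x, N k x -> ran_sqrt A x -> x = vzero) /\
    (forall k x, orth (N k) x -> ran_sqrt A x -> x = vzero) /\
    (forall x, (forall k, orth (N k) x) -> x = vzero) /\
    (forall (x : H) (p : nat -> H), (forall k, is_proj (N k) x (p k)) ->
       forall eps, 0 < eps -> exists K, forall k, (k >= K)%nat -> hnorm (vsub x (p k)) < eps).
Proof.
  intros HA not_onto.
  (* The tolerance is the square of [16^-n] because [ran_sqrt_decay] bounds squared coordinates. *)
  destruct (adapted_basis A HA not_onto (fun n => (w n * w n)²)) as (b & Hb & Ht & small).
  { intro n. pose proof (w_pos n). unfold Rsqr. repeat apply Rmult_lt_0_compat; auto. }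
  destruct (functional_choice (fun f x => decaying f -> forall v, sums (fun n => f n * rin v (b n)) (rin v x)))
    as [vec vec_spec].
  { intro f. destruct (classic (decaying f)) as [h|h].
    - destruct (synthesis b Hb f h) as [x hx]. exists x; auto.
    - exists vzero. intro; contradiction. }
  pose proof (ran_sqrt_rapid A HA b small) as rap.
  assert (sub : forall k, subspace (orth (graph_part vec k))) by (intro; apply subspace_orth).
  assert (mon : forall k x, orth (graph_part vec k) x -> orth (graph_part vec (S k)) x).
  { intros k x. apply orth_antitone. intros y [h1 h2]. split; auto. }
  assert (all : forall x, (forall k, orth (orth (graph_part vec k)) x) -> x = vzero)
    by apply (orth_orth_graph_part_all b Hb Ht vec vec_spec).
  exists (fun k => orth (graph_part vec k)). repeat apply conj; auto.
  - intros k x ho hx. apply (orth_graph_part_rapid b Hb Ht vec vec_spec k); auto.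
  - intros k x ho hx. apply (orth_orth_graph_part_rapid b Ht vec vec_spec k); auto.
  - now apply monotone_proj_cv.
Qed.
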